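(* Let $a,b>0$ and $g\in L^2(\mathbb{R})$ be such that $(g,a,b)$ is a Gabor frame for $L^2(\mathbb{R})$ with frame operator $S$, and let $h^0=S^{-1/2}g$. Then for any $h\in L^2(\mathbb{R})$ for which $(h,a,b)$ is a normalized tight Gabor frame, $$\|g-h^0\|\le \|g-h\|\le \|g+h^0\|,$$ where $\|\cdot\|$ is the norm of $L^2(\mathbb{R})$.
   Context: For $g\in L^2(\mathbb{R})$ and $a,b>0$ write $g_{na,mb}(t)=e^{2\pi i mbt}g(t-na)$, $n,m\in\mathbb{Z}$. The triple $(g,a,b)$ is a (Gabor) frame for $L^2(\mathbb{R})$ if there are constants $A,B>0$ (frame bounds) such that $A\|f\|^2\le\sum_{n,m\in\mathbb{Z}}|\langle f,g_{na,mb}\rangle|^2\le B\|f\|^2$ for all $f\in L^2(\mathbb{R})$. It is a normalized tight frame if this holds with $A=B=1$. The frame operator is $Sf=\sum_{n,m\in\mathbb{Z}}\langle f,g_{na,mb}\rangle g_{na,mb}$; it is bounded, self-adjoint and satisfies $AI\le S\le BI$, so $S^{-1/2}$ is well defined. The window $h^0=S^{-1/2}g$ is called the canonical tight window. *)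

(* Defs.v *)
From mathcomp Require Import all_boot all_order all_algebra.
From mathcomp Require Import finmap.
From mathcomp Require Import complex.
From mathcomp Require Import all_classical all_reals all_analysis.

Set Implicit Arguments.
Unset Strict Implicit.
Unset Printing Implicit Defensive.

Import Order.TTheory GRing.Theory Num.Theory.
Import numFieldNormedType.Exports.

Local Open Scope classical_set_scope.
Local Open Scope ring_scope.
Local Open Scope complex_scope.

(* Elements of L^2(R) are represented by square-integrable functions R -> C,
   taken up to equality almost everywhere. *)

Definition cabs (R : realType) (z : R[i]) : R :=
  Num.sqrt (complex.Re z ^+ 2 + complex.Im z ^+ 2).

Definition Lnorm2 (R : realType) (f : R -> R[i]) : \bar R :=
  Lnorm (@lebesgue_measure R) 2%:E (fun t => (cabs (f t))%:E).

Definition L2 (R : realType) : set (R -> R[i]) :=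
  [set f | [/\ measurable_fun [set: R] (fun t => complex.Re (f t)),
               measurable_fun [set: R] (fun t => complex.Im (f t)) &
               (Lnorm2 f < +oo)%E]].

Definition norm2 (R : realType) (f : R -> R[i]) : R := fine (Lnorm2 f).

Definition eq_ae (R : realType) (f g : R -> R[i]) : Prop :=
  f = g %[ae @lebesgue_measure R].

Definition cintegral (R : realType) (f : R -> R[i]) : R[i] :=
  Rintegral (@lebesgue_measure R) [set: R] (fun t => complex.Re (f t)) +i*
  Rintegral (@lebesgue_measure R) [set: R] (fun t => complex.Im (f t)).

Definition inner (R : realType) (f g : R -> R[i]) : R[i] :=
  cintegral (fun t => f t * (g t)^*).

Definition cis (R : realType) (x : R) : R[i] := cos x +i* sin x.

Definition gabor_atom (R : realType) (g : R -> R[i]) (a b : R)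
    (k : int * int) : R -> R[i] :=
  fun t => cis (2 * pi * (k.2%:~R * b) * t) * g (t - k.1%:~R * a).

Definition gabor_frame_bounds (R : realType) (g : R -> R[i]) (a b A B : R) :
    Prop :=
  forall f, L2 f ->
    ((A * norm2 f ^+ 2)%:E <=
       \esum_(k in [set: int * int])
          (cabs (inner f (gabor_atom g a b k)) ^+ 2)%:E)%E /\
    (\esum_(k in [set: int * int])
        (cabs (inner f (gabor_atom g a b k)) ^+ 2)%:E <=
      (B * norm2 f ^+ 2)%:E)%E.

Definition gabor_frame (R : realType) (g : R -> R[i]) (a b : R) : Prop :=
  exists A B : R, [/\ 0 < A, 0 < B & gabor_frame_bounds g a b A B].

Definition normalized_tight_gabor_frame (R : realType) (g : R -> R[i])
    (a b : R) : Prop :=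
  gabor_frame_bounds g a b 1 1.

(* The series over Z x Z converges unconditionally in L^2: its finite partial
   sums converge along the directed set of finite subsets of Z x Z. *)
Definition is_frame_operator (R : realType) (g : R -> R[i]) (a b : R)
    (S : (R -> R[i]) -> (R -> R[i])) : Prop :=
  forall f, L2 f -> L2 (S f) /\
    forall e : R, 0 < e -> exists F0 : {fset int * int},
      forall F : {fset int * int}, (F0 `<=` F)%fset ->
        norm2 (fun t => S f t -
          \sum_(k <- F) inner f (gabor_atom g a b k) * gabor_atom g a b k t)
        < e.

Definition bounded_linear (R : realType) (T : (R -> R[i]) -> (R -> R[i])) :
    Prop :=
  [/\ forall f, L2 f -> L2 (T f),
      forall (c : R[i]) f g, L2 f -> L2 g ->
        eq_ae (T (fun t => c * f t + g t)) (fun t => c * T f t + T g t) &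
      exists M : R, forall f, L2 f -> norm2 (T f) <= M * norm2 f].

Definition self_adjoint (R : realType) (T : (R -> R[i]) -> (R -> R[i])) :
    Prop :=
  forall f g, L2 f -> L2 g -> inner (T f) g = inner f (T g).

(* In R[i], [0 <= z] means that z is real and nonnegative. *)
Definition nonneg_op (R : realType) (T : (R -> R[i]) -> (R -> R[i])) : Prop :=
  forall f, L2 f -> 0 <= inner (T f) f.

(* T = S^{-1/2}, i.e. T is the nonnegative square root of the inverse of S; as
   an operator on L^2 modulo a.e. equality it is determined by S. *)
Definition is_inv_sqrt (R : realType) (S T : (R -> R[i]) -> (R -> R[i])) :
    Prop :=
  [/\ bounded_linear T, self_adjoint T, nonneg_op T &
      forall f, L2 f -> eq_ae (T (T (S f))) f /\ eq_ae (S (T (T f))) f].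

(* Main.v *)
(* Let pi be the time-frequency shifts, Q = S^{1/2} (so Q h^0 = g), and write
   ||.|| and <.,.> for the norm and inner product of L^2(R).  For a self-adjoint
   operator A commuting with every pi_k and two normalized tight windows h, k,
   expanding A h in the frame of k and A k in the frame of h gives the same sum
   of squares, so ||A h|| = ||A k||: the vector state of a tight window is a
   trace which does not depend on the window.  With A = 1 and A = Q +- 1 this
   yields ||h|| = ||h^0|| and <Q h, h> = <Q h^0, h^0> = <g, h^0>, after which
   0 <= <Q (h^0 -+ h), h^0 -+ h> reads +-Re <g, h> <= <g, h^0>, which is the
   theorem.  It remains that T = S^{-1/2} commutes with the shifts although only
   S visibly does; this is proved by a contraction argument on the commutator,
   without functional calculus. *)

From HB Require Import structures.
Require Import Defs.
From mathcomp Require Import all_boot all_order all_algebra.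
From mathcomp Require Import finmap complex ring lra.
From mathcomp Require Import all_classical all_reals all_analysis.
From mathcomp Require Import measurable_realfun.

Set Implicit Arguments.
Unset Strict Implicit.
Unset Printing Implicit Defensive.

Import Order.TTheory GRing.Theory Num.Theory.
Import numFieldNormedType.Exports.

Local Open Scope classical_set_scope.
Local Open Scope ring_scope.
Local Open Scope complex_scope.

(** * Real and imaginary parts, squared modulus *)

Section ComplexNumbers.
Variable R : realType.
Implicit Types (x y : R) (z w : R[i]).

Lemma ReD z w : complex.Re (z + w) = complex.Re z + complex.Re w.
Proof. by case: z; case: w. Qed.

Lemma ImD z w : complex.Im (z + w) = complex.Im z + complex.Im w.
Proof. by case: z; case: w. Qed.

Lemma ReM z w : complex.Re (z * w) =
  complex.Re z * complex.Re w - complex.Im z * complex.Im w.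
Proof. by case: z; case: w. Qed.

Lemma ImM z w : complex.Im (z * w) =
  complex.Re z * complex.Im w + complex.Im z * complex.Re w.
Proof. by case: z => a b; case: w => c d /=; rewrite addrC. Qed.

Lemma Re_conj z : complex.Re z^* = complex.Re z.
Proof. by case: z. Qed.

Lemma Im_conj z : complex.Im z^* = - complex.Im z.
Proof. by case: z. Qed.

Lemma complex_eqP z w :
  complex.Re z = complex.Re w -> complex.Im z = complex.Im w -> z = w.
Proof. by case: z => a b; case: w => c d /= -> ->. Qed.

Lemma cabs_sq z : cabs z ^+ 2 = complex.Re z ^+ 2 + complex.Im z ^+ 2.
Proof. by rewrite sqr_sqrtr // addr_ge0 ?sqr_ge0. Qed.

Lemma cabsM_sq z w : cabs (z * w) ^+ 2 = cabs z ^+ 2 * cabs w ^+ 2.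
Proof. by rewrite !cabs_sq ReM ImM; ring. Qed.

Lemma cabs_conj z : cabs z^* = cabs z.
Proof. by rewrite /cabs Re_conj Im_conj sqrrN. Qed.

Lemma mulC_conj z : z^* * z = (cabs z ^+ 2)%:C.
Proof.
rewrite cabs_sq; apply: complex_eqP; rewrite ?ReM ?ImM Re_conj Im_conj /=;
by ring.
Qed.

End ComplexNumbers.

(** * Square-integrable functions and their inner product *)

Section L2.
Variable R : realType.
Local Notation mu := (@lebesgue_measure R).
Implicit Types (f g u v : R -> R[i]) (c : R[i]) (x : R).

Lemma Lnorm2_sqE f : (Lnorm2 f `^ 2 = \int[mu]_t (cabs (f t) ^+ 2)%:E)%E.
Proof.
rewrite /Lnorm2 poweR_Lnorm //; apply: eq_integral => t _ /=.
by rewrite ger0_norm ?sqrtr_ge0 // powR_mulrn // sqrtr_ge0.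
Qed.

Definition cmeasurable f :=
  measurable_fun [set: R] (fun t => complex.Re (f t)) /\
  measurable_fun [set: R] (fun t => complex.Im (f t)).

Definition cintegrable f :=
  mu.-integrable [set: R] (EFin \o (fun t => complex.Re (f t))) /\
  mu.-integrable [set: R] (EFin \o (fun t => complex.Im (f t))).

Lemma L2P f : L2 f <->
  cmeasurable f /\ (\int[mu]_t (cabs (f t) ^+ 2)%:E < +oo)%E.
Proof.
rewrite -Lnorm2_sqE; split=> [[mr mi fin]|[[mr mi] fin]].
  by split => //; exact: poweR_lty.
by split => //; exact: (@lty_poweRy _ _ 2).
Qed.

Lemma norm2_sqE f : L2 f ->
  (norm2 f ^+ 2)%:E = (\int[mu]_t (cabs (f t) ^+ 2)%:E)%E.
Proof.
move=> [_ _ fin]; rewrite -Lnorm2_sqE /norm2.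
have : Lnorm2 f \is a fin_num by rewrite ge0_fin_numE // Lnorm_ge0.
have : (0 <= Lnorm2 f)%E by exact: Lnorm_ge0.
case: (Lnorm2 f) => //= r r0 _.
by rewrite powR_mulrn.
Qed.

Lemma norm2_ge0 f : 0 <= norm2 f.
Proof. by rewrite fine_ge0 // Lnorm_ge0. Qed.

Lemma cmeasurable_comb c f g : cmeasurable f -> cmeasurable g ->
  cmeasurable (fun t => c * f t + g t).
Proof.
move=> [fr fi] [gr gi]; split.
  under eq_fun do rewrite ReD ReM.
  apply: measurable_funD => //.
  by apply: measurable_funB; apply: measurable_funM.
under eq_fun do rewrite ImD ImM.
apply: measurable_funD => //.
by apply: measurable_funD; apply: measurable_funM.
Qed.

Lemma cmeasurableM f g : cmeasurable f -> cmeasurable g ->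
  cmeasurable (fun t => f t * g t).
Proof.
move=> [fr fi] [gr gi]; split.
  under eq_fun do rewrite ReM.
  by apply: measurable_funB; apply: measurable_funM.
under eq_fun do rewrite ImM.
by apply: measurable_funD => //; apply: measurable_funM.
Qed.

Lemma cmeasurable_conj f : cmeasurable f -> cmeasurable (fun t => (f t)^*).
Proof.
move=> [fr fi]; split.
  by under eq_fun do rewrite Re_conj.
by under eq_fun do rewrite Im_conj; exact: measurableT_comp.
Qed.

Lemma measurable_cabs_sq f : cmeasurable f ->
  measurable_fun [set: R] (fun t => cabs (f t) ^+ 2).
Proof.
move=> [fr fi]; under eq_fun do rewrite cabs_sq.
by apply: measurable_funD; exact: measurable_funX.
Qed.

Lemma L2_integrable_sq f : L2 f ->
  mu.-integrable [set: R] (EFin \o (fun t => cabs (f t) ^+ 2)).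
Proof.
move=> /L2P[mf fin]; apply/integrableP; split.
  by apply/measurable_EFinP; exact: measurable_cabs_sq.
by under eq_integral do rewrite /= ger0_norm ?sqr_ge0 //.
Qed.

Lemma L2_comb c f g : L2 f -> L2 g -> L2 (fun t => c * f t + g t).
Proof.
move=> lf lg; have /L2P[mf _] := lf; have /L2P[mg _] := lg.
have mfg := cmeasurable_comb c mf mg.
apply/L2P; split => //.
have ifg : mu.-integrable [set: R] (EFin \o (fun t =>
    (cabs c ^+ 2 *+ 2) * cabs (f t) ^+ 2 + 2 * cabs (g t) ^+ 2)).
  exact: (integrableD measurableT
    (integrableZl measurableT _ (L2_integrable_sq lf))
    (integrableZl measurableT _ (L2_integrable_sq lg))).
have /integrableP[_] := ifg; apply: le_lt_trans.
apply: ge0_le_integral => //.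
- by move=> t _; rewrite lee_fin sqr_ge0.
- by apply/measurable_EFinP; exact: measurable_cabs_sq mfg.
- by apply: measurableT_comp => //; case/integrableP: ifg.
move=> t _; rewrite lee_fin ger0_norm; last first.
  by rewrite addr_ge0 // mulr_ge0 ?mulrn_wge0 ?sqr_ge0.
rewrite !cabs_sq ReD ImD ReM ImM; move: {mfg ifg}c (f t) (g t).
move=> [c1 c2] [f1 f2] [g1 g2] /=.
(* These two squares add up to the squared modulus of [c f - g], so the bound is the parallelogram
   identity. *)
have := sqr_ge0 (c1 * f1 - c2 * f2 - g1).
have := sqr_ge0 (c1 * f2 + c2 * f1 - g2).
nra.
Qed.

Lemma integrable_le_sq (w : R -> R) f g : L2 f -> L2 g ->
  measurable_fun [set: R] w ->
  (forall t, `|w t| <= cabs (f t) ^+ 2 + cabs (g t) ^+ 2) ->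
  mu.-integrable [set: R] (EFin \o w).
Proof.
move=> lf lg mw wle.
have ifg := integrableD measurableT (L2_integrable_sq lf) (L2_integrable_sq lg).
apply: (le_integrable measurableT _ _ ifg); first exact/measurable_EFinP.
by move=> t _; rewrite /= lee_fin (le_trans (wle t)) // ler_norm.
Qed.

Lemma cintegrable_inner f g : L2 f -> L2 g ->
  cintegrable (fun t => f t * (g t)^*).
Proof.
move=> lf lg; have /L2P[mf _] := lf; have /L2P[mg _] := lg.
have [mr mi] := cmeasurableM mf (cmeasurable_conj mg).
split; apply: (integrable_le_sq lf lg) => // t.
  rewrite !cabs_sq ReM Re_conj Im_conj.
  move: (f t) (g t) => [f1 f2] [g1 g2] /=; rewrite ler_norml.
  have := sqr_ge0 (f1 - g1); have := sqr_ge0 (f2 - g2).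
  have := sqr_ge0 (f1 + g1); have := sqr_ge0 (f2 + g2).
  by move=> ? ? ? ?; apply/andP; split; nra.
rewrite !cabs_sq ImM Re_conj Im_conj.
move: (f t) (g t) => [f1 f2] [g1 g2] /=; rewrite ler_norml.
have := sqr_ge0 (f1 - g2); have := sqr_ge0 (f2 - g1).
have := sqr_ge0 (f1 + g2); have := sqr_ge0 (f2 + g1).
by move=> ? ? ? ?; apply/andP; split; nra.
Qed.

(** Three terms, because each part of [c * u + v] combines both parts of [u] with one part of
    [v]. *)
Lemma Rintegral_comb (a b : R) (p q r : R -> R) :
  mu.-integrable [set: R] (EFin \o p) -> mu.-integrable [set: R] (EFin \o q) ->
  mu.-integrable [set: R] (EFin \o r) ->
  Rintegral mu [set: R] (fun t => a * p t + b * q t + r t) =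
  a * Rintegral mu [set: R] p + b * Rintegral mu [set: R] q +
  Rintegral mu [set: R] r.
Proof.
move=> ip iq ir.
have iap : mu.-integrable [set: R] (EFin \o (fun t => a * p t)).
  exact: (integrableZl measurableT a ip).
have ibq : mu.-integrable [set: R] (EFin \o (fun t => b * q t)).
  exact: (integrableZl measurableT b iq).
have iapbq : mu.-integrable [set: R] (EFin \o (fun t => a * p t + b * q t)).
  exact: (integrableD measurableT iap ibq).
rewrite (RintegralD measurableT iapbq ir) (RintegralD measurableT iap ibq).
by rewrite !RintegralZl.
Qed.

Lemma cintegral_comb c u v : cintegrable u -> cintegrable v ->
  cintegral (fun t => c * u t + v t) = c * cintegral u + cintegral v.
Proof.
move=> [ur ui] [vr vi]; apply: complex_eqP.
  rewrite ReD ReM -mulNr -Rintegral_comb //=.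
  by apply: eq_Rintegral => t _; rewrite ReD ReM mulNr.
rewrite ImD ImM -Rintegral_comb //=.
by apply: eq_Rintegral => t _; rewrite ImD ImM.
Qed.

Lemma inner_comb c f g h : L2 f -> L2 g -> L2 h ->
  inner (fun t => c * f t + g t) h = c * inner f h + inner g h.
Proof.
move=> lf lg lh; rewrite /inner -cintegral_comb; [|exact: cintegrable_inner..].
by congr cintegral; apply: funext => t; rewrite mulrDl mulrA.
Qed.

Lemma inner_conj f g : L2 f -> L2 g -> inner g f = (inner f g)^*.
Proof.
move=> lf lg; have [ir ii] := cintegrable_inner lf lg.
apply: complex_eqP; rewrite /inner /cintegral /=.
  by apply: eq_Rintegral => t _; rewrite !ReM !Re_conj !Im_conj; ring.
rewrite -mulN1r -RintegralZl //; apply: eq_Rintegral => t _.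
by rewrite !ImM !Re_conj !Im_conj; ring.
Qed.

Lemma inner_self f : L2 f -> complex.Re (inner f f) = norm2 f ^+ 2.
Proof.
move=> lf; apply: EFin_inj; rewrite norm2_sqE // /inner /cintegral /=.
rewrite /Rintegral fineK; last first.
  have [ir _] := cintegrable_inner lf lf; exact: integrable_fin_num.
apply: eq_integral => t _; rewrite cabs_sq ReM Re_conj Im_conj.
by congr _%:E; ring.
Qed.

Lemma inner_eq_ae f g h : L2 f -> L2 g -> L2 h -> eq_ae f g ->
  inner f h = inner g h.
Proof.
move=> lf lg lh fg.
have /L2P[mf _] := lf; have /L2P[mg _] := lg; have /L2P[mh _] := lh.
have {fg}[N [mN N0 fgN]] := fg.
have [fr fi] := cmeasurableM mf (cmeasurable_conj mh).
have [gr gi] := cmeasurableM mg (cmeasurable_conj mh).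
apply: complex_eqP; rewrite /inner /cintegral /= /Rintegral; congr fine.
  apply: ae_eq_integral => //; [exact/measurable_EFinP..|].
  exists N; split => // t /= ne; apply: fgN => /= e.
  by apply: ne => _; rewrite e.
apply: ae_eq_integral => //; [exact/measurable_EFinP..|].
exists N; split => // t /= ne; apply: fgN => /= e.
by apply: ne => _; rewrite e.
Qed.

(** * Translation invariance of the integral *)

Lemma measurable_shift x : measurable_fun [set: R] (fun t : R => t - x).
Proof. exact: measurable_funB. Qed.

(** Lebesgue measure is determined by its values on half-open intervals, whose length a translation
    preserves. *)
Lemma lebesgue_measure_shift x (A : set R) : measurable A ->
  pushforward mu ((fun t => t - x) : _ -> measurableTypeR R) A = mu A.
Proof.
move=> mA; apply/esym/lebesgue_measure_unique => //=.
  exact: measurable_shift.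
move=> _ _ [[u v]] _ <-; rewrite /pushforward.
have -> : (fun t => t - x) @^-1` `]u, v]%classic = `]u + x, v + x]%classic.
  by apply/seteqP; split => t /=; rewrite !in_itv /= ltrBrDr lerBlDr.
rewrite !lebesgue_measure_itv /= !lte_fin ltrD2r; case: ifP => // _.
by rewrite -!EFinB; congr _%:E; ring.
Qed.

Lemma ge0_integral_shift x (w : R -> \bar R) : measurable_fun [set: R] w ->
  (forall t, 0 <= w t)%E -> (\int[mu]_t w (t - x)%R = \int[mu]_t w t)%E.
Proof.
move=> mw w0; rewrite (_ : [set: R] =
    ((fun t => t - x) : _ -> measurableTypeR R) @^-1` [set: R]) //.
rewrite -ge0_integral_pushforward //=; last exact: measurable_shift.
rewrite preimage_setT; apply: eq_measure_integral.
  exact: measurable_shift.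
by move=> ? A mA _; exact: lebesgue_measure_shift.
Qed.

Lemma integral_shift x (w : R -> \bar R) : measurable_fun [set: R] w ->
  (\int[mu]_t w (t - x)%R = \int[mu]_t w t)%E.
Proof.
move=> mw; rewrite integralE [RHS]integralE.
have wE : (fun t => w (t - x)%R) = w \o (fun t => t - x) by [].
rewrite wE funepos_comp funeneg_comp.
rewrite (ge0_integral_shift x (measurable_funepos mw) (funepos_ge0 w)).
by rewrite (ge0_integral_shift x (measurable_funeneg mw) (funeneg_ge0 w)).
Qed.

Lemma cmeasurable_shift x f : cmeasurable f -> cmeasurable (fun t => f (t - x)).
Proof.
move=> [fr fi]; split; first exact: (measurableT_comp fr (measurable_shift x)).
exact: (measurableT_comp fi (measurable_shift x)).
Qed.

Lemma L2_shift x f : L2 f -> L2 (fun t => f (t - x)).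
Proof.
move=> /L2P[mf fin]; apply/L2P; split; first exact: cmeasurable_shift.
rewrite (integral_shift x (w := fun t => (cabs (f t) ^+ 2)%:E)) //.
by apply/measurable_EFinP; exact: measurable_cabs_sq.
Qed.

Lemma cintegral_shift x f : cmeasurable f ->
  cintegral (fun t => f (t - x)) = cintegral f.
Proof.
have shiftE (w : R -> R) : measurable_fun [set: R] w ->
    Rintegral mu [set: R] (fun t => w (t - x)) = Rintegral mu [set: R] w.
  move=> /measurable_EFinP mw.
  by rewrite /Rintegral (integral_shift x (w := EFin \o w)).
by move=> [fr fi]; apply: complex_eqP; [exact: shiftE fr | exact: shiftE fi].
Qed.

Lemma cabs_cis x : cabs (cis x) ^+ 2 = 1.
Proof. by rewrite cabs_sq /= cos2Dsin2. Qed.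

Lemma cisD x y : cis (x + y) = cis x * cis y.
Proof.
apply: complex_eqP; rewrite ?ReM ?ImM /=; first by rewrite cosD.
by rewrite sinD addrC.
Qed.

Lemma cmeasurable_cis (y : R) : cmeasurable (fun t => cis (y * t)).
Proof.
have my : measurable_fun [set: R] ( *%R y) by exact: mulrl_measurable.
split; apply: (measurableT_comp _ my); apply: continuous_measurable_fun.
  exact: continuous_cos.
exact: continuous_sin.
Qed.

(** * Time-frequency shifts as a projective unitary representation *)

Variables a b : R.
Local Notation K := (int * int)%type.
Local Notation pi k f := (gabor_atom f a b k).

Lemma L2_gabor_atom k f : L2 f -> L2 (pi k f).
Proof.
move=> /(L2_shift (k.1%:~R * a)) /L2P[mf fin]; apply/L2P; split.
  exact: (cmeasurableM (cmeasurable_cis _)).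
under eq_integral do rewrite cabsM_sq cabs_cis mul1r.
exact: fin.
Qed.

Lemma gabor_atom_comb k c f g : pi k (fun t => c * f t + g t) =
  (fun t => c * pi k f t + pi k g t).
Proof. by apply: funext => t; rewrite /gabor_atom mulrDr mulrCA. Qed.

Lemma inner_gabor_atom k f g : L2 f -> L2 g ->
  inner (pi k f) (pi k g) = inner f g.
Proof.
move=> /L2P[mf _] /L2P[mg _].
rewrite -[RHS](cintegral_shift (k.1%:~R * a)); last first.
  exact: (cmeasurableM mf (cmeasurable_conj mg)).
congr cintegral; apply: funext => t; rewrite /gabor_atom rmorphM /= mulrACA.
by rewrite [X in X * _]mulrC mulC_conj cabs_cis mul1r.
Qed.

Lemma gabor_atom0 f : pi 0 f = f.
Proof.
apply: funext => t; rewrite /gabor_atom !mul0r subr0 mulr0 mul0r.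
by rewrite /cis cos0 sin0 mul1r.
Qed.

(** Translating by [j.1 a] past the modulation of frequency [k.2 b] leaves a constant phase, so
    composition is additive in the indices only up to a unimodular factor. *)
Lemma gabor_atomD j k : exists c, cabs c ^+ 2 = 1 /\
  forall f t, pi j (pi k f) t = c * pi (j + k) f t.
Proof.
exists (cis (- (2 * trigo.pi * (k.2%:~R * b) * (j.1%:~R * a)))).
split; first exact: cabs_cis.
move=> f t; rewrite /gabor_atom !mulrA -!cisD /= !rmorphD /=.
by congr (cis _ * f _); ring.
Qed.

End L2.

(** * Two facts about real numbers *)

Lemma discriminant_le (R : realType) (a b c : R) : 0 <= c ->
  (forall t, 0 <= a + t * b *+ 2 + t ^+ 2 * c) -> b ^+ 2 <= a * c.
Proof.
rewrite le_eqVlt => /predU1P[<-|c0] H.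
  have [->|b0] := eqVneq b 0; first by rewrite mulr0 expr0n.
  (* For [c = 0] the polynomial is affine, and at this point it would equal [-1]. *)
  have := H (- (a + 1) / (b *+ 2)).
  by rewrite mulr0 addr0 -mulrnAr mulfVK ?mulrn_eq0 //; lra.
(* This is the minimiser of the quadratic. *)
have := H (- b / c); rewrite -(pmulr_rge0 _ c0).
suff -> : c * (a + - b / c * b *+ 2 + (- b / c) ^+ 2 * c) = a * c - b ^+ 2.
  by rewrite subr_ge0.
by field; rewrite gt_eqF.
Qed.

Lemma geometric_le0 (R : realType) (x c q : R) : 0 <= q < 1 ->
  (forall n, x <= c * q ^+ n) -> x <= 0.
Proof.
move=> /andP[q0 q1] H.
have cv : (fun n => c * q ^+ n) @ \oo --> c * 0.
  by apply: cvgMr; apply: cvg_expr; rewrite ger0_norm.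
rewrite -(mulr0 c) -(cvg_lim _ cv) //.
by apply: limr_ge; [exact: cvgP cv | exact: nearW].
Qed.

(** * Abstract semi-inner product spaces; null vectors are allowed, as for functions vanishing
    a.e *)

Section SemiInnerProduct.
Variables (R : realType) (V : lmodType R[i]) (ip : V -> V -> R[i]).
Hypothesis ipPl : forall c f g w, ip (c *: f + g) w = c * ip f w + ip g w.
Hypothesis ipC : forall f g, ip g f = (ip f g)^*.
Hypothesis ip_ge0 : forall f, 0 <= complex.Re (ip f f).
Implicit Types (f g h u v w : V) (A : V -> V).

Local Notation rip f g := (complex.Re (ip f g)).
Local Notation nsq f := (rip f f).

(* Equality modulo null vectors, i.e. a.e. equality in the case of L^2. *)
Definition ip_equiv f g := forall w, ip f w = ip g w.
Local Notation "f ~~ g" := (ip_equiv f g) (at level 70).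

Definition ip_selfadj A := forall f g, ip (A f) g = ip f (A g).

Lemma ip0l w : ip 0 w = 0.
Proof. by have := ipPl (-1) 0 0 w; rewrite scaler0 addr0 mulN1r addNr. Qed.

Lemma ipZl c f w : ip (c *: f) w = c * ip f w.
Proof. by rewrite -[c *: f]addr0 ipPl ip0l addr0. Qed.

Lemma ipZr c f w : ip w (c *: f) = c^* * ip w f.
Proof. by rewrite ipC ipZl rmorphM /= -ipC. Qed.

Lemma ipPr c f g w : ip w (c *: f + g) = c^* * ip w f + ip w g.
Proof. by rewrite ipC ipPl rmorphD rmorphM /= -!ipC. Qed.

Lemma ip_equiv_sym f g : f ~~ g -> g ~~ f.
Proof. by move=> fg w; rewrite fg. Qed.

Lemma ip_equiv_trans g f h : f ~~ g -> g ~~ h -> f ~~ h.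
Proof. by move=> fg gh w; rewrite fg. Qed.

Lemma ip_equivr f g w : f ~~ g -> ip w f = ip w g.
Proof. by move=> fg; rewrite ipC fg -ipC. Qed.

Lemma ripC f g : rip f g = rip g f.
Proof. by rewrite ipC Re_conj. Qed.

Lemma ripPl x f g w : rip (x%:C *: f + g) w = x * rip f w + rip g w.
Proof. by rewrite ipPl ReD ReM /= mul0r subr0. Qed.

Lemma ripPr x f g w : rip w (x%:C *: f + g) = x * rip w f + rip w g.
Proof. by rewrite ripC ripPl ![rip w _]ripC. Qed.

Lemma nsqP x f g :
  nsq (x%:C *: f + g) = x ^+ 2 * nsq f + x * rip f g *+ 2 + nsq g.
Proof. by rewrite ripPl !ripPr (ripC g f); ring. Qed.

(** Moving [A] to the other argument turns linearity of the form into linearity of [A] up to null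
    vectors. *)
Lemma selfadjP A c f g : ip_selfadj A -> A (c *: f + g) ~~ c *: A f + A g.
Proof. by move=> sA w; rewrite sA !ipPl !sA. Qed.

Lemma selfadj_equiv A f g : ip_selfadj A -> f ~~ g -> A f ~~ A g.
Proof. by move=> sA fg w; rewrite !sA. Qed.

Lemma cauchy_schwarz f g : rip f g ^+ 2 <= nsq f * nsq g.
Proof.
apply: discriminant_le => // t.
suff -> : nsq f + t * rip f g *+ 2 + t ^+ 2 * nsq g = nsq (t%:C *: g + f) by [].
by rewrite nsqP (ripC g f); ring.
Qed.

(** Cauchy-Schwarz for the semi-inner product induced by a nonnegative [A]. *)
Lemma cauchy_schwarz_op A f g : ip_selfadj A -> (forall u, 0 <= rip (A u) u) ->
  rip (A f) g ^+ 2 <= rip (A f) f * rip (A g) g.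
Proof.
move=> sA A0; apply: discriminant_le => // t.
suff -> : rip (A f) f + t * rip (A f) g *+ 2 + t ^+ 2 * rip (A g) g
        = rip (A (t%:C *: g + f)) (t%:C *: g + f) by [].
rewrite (selfadjP _ _ _ sA) ripPl !ripPr.
have -> : rip (A g) f = rip (A f) g by rewrite sA ripC.
by ring.
Qed.

Lemma nsq0_equiv f g : nsq ((-1)%:C *: g + f) <= 0 -> f ~~ g.
Proof.
set d := _ + f => d0 w.
have dw v : rip d v = 0.
  apply/eqP; rewrite -sqrf_eq0 eq_le sqr_ge0 andbT.
  by rewrite (le_trans (cauchy_schwarz _ _)) // mulr_le0_ge0.
have dR : rip d w = rip f w - rip g w by rewrite ripPl; ring.
have dI : complex.Im (ip d w) = complex.Im (ip f w) - complex.Im (ip g w).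
  by rewrite ipPl ImD ImM /=; ring.
(* The real part of the pairing with [i w] is the imaginary part of the pairing with [w]. *)
have := dw ('i%C *: w); rewrite ipZr ReM /= => dw2.
apply: complex_eqP; apply/eqP; rewrite -subr_eq0.
  by rewrite -dR dw.
by rewrite -dI; apply/eqP; lra.
Qed.

(** * Commutation passes from the square of a positive operator to the operator *)

Section Commutation.
Variables (T : V -> V) (M B : R).
Hypothesis T_selfadj : ip_selfadj T.
Hypothesis T_ge0 : forall f, 0 <= rip (T f) f.
Hypothesis M_ge1 : 1 <= M.
Hypothesis T_bounded : forall f, nsq (T f) <= M ^+ 2 * nsq f.
Hypothesis B_ge1 : 1 <= B.
Hypothesis T_below : forall f, nsq f <= B * nsq (T f).

(** [cauchy_schwarz_op] at [f] and [T f] bounds [||T f||^4] by [<T f, f> <T T f, T f>], and the last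
    factor is at most [M ||T f||^2]. *)
Lemma nsq_image_le f : nsq (T f) <= M * rip (T f) f.
Proof.
have M0 : 0 < M by rewrite (lt_le_trans ltr01).
have [->|n0] := eqVneq (nsq (T f)) 0; first by rewrite mulr_ge0 // ltW.
have npos : 0 < nsq (T f) by rewrite lt_neqAle eq_sym n0 ip_ge0.
rewrite -(ler_pM2r npos) -expr2.
apply: (le_trans (cauchy_schwarz_op _ _ T_selfadj T_ge0)).
rewrite -mulrA mulrCA ler_wpM2l //.
rewrite -(@ler_pXn2r _ 2) ?nnegrE ?mulr_ge0 //; last exact: ltW.
apply: (le_trans (cauchy_schwarz _ _)).
by rewrite exprMn [_ ^+ 2 in leRHS]expr2 mulrA ler_wpM2r.
Qed.

(** In the expanded square, half of the cross term absorbs [||T f||^2 / M^2] by [nsq_image_le]; the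
    other half still subtracts at least that much, which [T_below] compares with [||f||^2]. *)
Lemma nsq_sub_scale_le f :
  nsq ((- M^-1)%:C *: T f + f) <= (1 - (B * M ^+ 2)^-1) * nsq f.
Proof.
have M0 : 0 < M by rewrite (lt_le_trans ltr01).
have B0 : 0 < B by rewrite (lt_le_trans ltr01).
have n1 := nsq_image_le f; have n2 := T_below f.
rewrite nsqP mulrBl mul1r.
have n3 : M ^- 2 * nsq (T f) <= M^-1 * rip (T f) f.
  rewrite -exprVn expr2 -mulrA ler_wpM2l ?invr_ge0 ?(ltW M0) //.
  by rewrite ler_pdivrMl.
have n4 : (B * M ^+ 2)^-1 * nsq f <= M ^- 2 * nsq (T f).
  rewrite [leRHS]mulrC invfM mulrAC ler_wpM2r ?invr_ge0 ?sqr_ge0 //.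
  by rewrite ler_pdivrMl.
rewrite sqrrN exprVn; lra.
Qed.

(* [D := T U - U T] anticommutes with [T], so [(1 + T/M) D = D (1 - T/M)]; the
   left factor expands norms and the right one contracts them strictly. *)
Lemma sqrt_commutes (U : V -> V) :
  (forall c f g, U (c *: f + g) = c *: U f + U g) ->
  (forall f g, ip (U f) (U g) = ip f g) ->
  (forall w, exists v, U v = w) ->
  (forall f, T (T (U f)) ~~ U (T (T f))) ->
  forall f, T (U f) ~~ U (T f).
Proof.
move=> U_lin U_iso U_onto TTU.
have M0 : 0 < M by rewrite (lt_le_trans ltr01).
have U_equiv f g : f ~~ g -> U f ~~ U g.
  by move=> fg w; have [v <-] := U_onto w; rewrite !U_iso.
(* The existential keeps [D] opaque to rewriting. *)
have [D DE] : exists D, forall f, D f = (-1)%:C *: U (T f) + T (U f) by eexists.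
(* [T D = T T U - T U T], and [T T U] may be replaced by [U T T]. *)
have TD f : T (D f) ~~ (-1)%:C *: D (T f).
  by move=> w; rewrite !DE (selfadjP _ _ _ T_selfadj) ipZl !ipPl TTU; ring.
have D_lin c f g : D (c *: f + g) ~~ c *: D f + D g.
  move=> w; rewrite DE !ipPl !DE.
  have /U_equiv -> := selfadjP c f g T_selfadj.
  by rewrite !U_lin (selfadjP _ _ _ T_selfadj) !ipPl; ring.
pose q : R := 1 - (B * M ^+ 2)^-1.
have BM1 : 1 <= B * M ^+ 2 by rewrite mulr_ege1 // exprn_ege1.
have BM0 : 0 < B * M ^+ 2 by rewrite (lt_le_trans ltr01).
have q01 : 0 <= q < 1.
  by rewrite subr_ge0 invf_le1 // BM1 /= ltrBlDr ltrDl invr_gt0.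
(* By anticommutation the right-hand vector is [D f + T (D f) / M], whose square exceeds that of
   [D f] by nonnegative terms since [T] is nonnegative. *)
have D_expand f : nsq (D f) <= nsq (D ((- M^-1)%:C *: T f + f)).
  have -> : nsq (D ((- M^-1)%:C *: T f + f)) = nsq ((M^-1)%:C *: T (D f) + D f).
    have e : D ((- M^-1)%:C *: T f + f) ~~ (M^-1)%:C *: T (D f) + D f.
      move=> w; rewrite D_lin ipPl [RHS]ipPl TD ipZl.
      by rewrite !rmorphN !rmorph1 /=; ring.
    by rewrite e (ip_equivr _ e).
  have Mi0 : 0 <= M^-1 by rewrite invr_ge0 ltW.
  by rewrite nsqP lerDr addr_ge0 ?mulrn_wge0 ?mulr_ge0 ?sqr_ge0.
(* Each round applies the bound to the contracted vector [f - T f / M] and gains a factor [q]; hence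
   [f] is quantified inside the induction. *)
have D_bound n : forall f, nsq (D f) <= 4 * M ^+ 2 * q ^+ n * nsq f.
  elim: n => [|n IHn] f.
    rewrite expr0 mulr1 DE nsqP sqrrN expr1n !mul1r.
    have h1 : nsq (U (T f)) <= M ^+ 2 * nsq f by rewrite U_iso.
    have h2 : nsq (T (U f)) <= M ^+ 2 * nsq f.
      by rewrite (le_trans (T_bounded _)) // U_iso.
    (* Parallelogram bound: [||D f||^2] is at most twice the sum of the two squares, whence the
       constant [4 M^2]. *)
    have := ip_ge0 (1%:C *: U (T f) + T (U f)); rewrite nsqP expr1n.
    lra.
  apply: (le_trans (D_expand f)); apply: (le_trans (IHn _)).
  rewrite [leRHS](_ : _ = 4 * M ^+ 2 * q ^+ n * (q * nsq f)); last first.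
    by rewrite (exprSr q); ring.
  rewrite ler_wpM2l ?nsq_sub_scale_le //.
  by case/andP: q01 => q0 _; rewrite !mulr_ge0 ?sqr_ge0 ?exprn_ge0 // ltW.
move=> f; apply: nsq0_equiv; rewrite -DE.
apply: (@geometric_le0 _ _ (4 * M ^+ 2 * nsq f) q) => // n.
by rewrite mulrAC; exact: D_bound.
Qed.

End Commutation.

(** * Frames generated by a projective unitary representation *)

Section ProjectiveRepresentation.
Variables (K : zmodType) (pi : K -> V -> V).
Hypothesis pi_lin : forall k c f g, pi k (c *: f + g) = c *: pi k f + pi k g.
Hypothesis pi_iso : forall k f g, ip (pi k f) (pi k g) = ip f g.
Hypothesis pi0 : forall f, pi 0 f = f.
Hypothesis piD : forall j k, exists c, cabs c ^+ 2 = 1 /\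
  forall f, pi j (pi k f) = c *: pi (j + k) f.

Local Notation csq z := (cabs z ^+ 2).

Definition frame_sum f g : \bar R :=
  \esum_(k in [set: K]) (csq (ip f (pi k g)))%:E.

Definition tight f := forall u, frame_sum u f = (nsq u)%:E.

Lemma pi_scale k c f : pi k (c *: f) = c *: pi k f.
Proof.
have pi00 : pi k 0 = 0.
  by have := pi_lin k (-1) 0 0; rewrite scaler0 addr0 scaleN1r addNr.
by rewrite -[c *: f]addr0 pi_lin pi00 addr0.
Qed.

Lemma pi_onto k w : exists v, pi k v = w.
Proof.
have [c [c1 piE]] := piD k (- k).
(* The factor [c^*] cancels the phase of [pi k] composed with [pi (- k)]. *)
exists (pi (- k) (c^* *: w)).
rewrite piE subrr pi0 scalerA mulrC mulC_conj c1.
by rewrite scale1r.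
Qed.

Lemma pi_equiv k f h : f ~~ h -> pi k f ~~ pi k h.
Proof. by move=> fh w; have [v <-] := pi_onto k w; rewrite !pi_iso. Qed.

Lemma csq_ipC f g : csq (ip f g) = csq (ip g f).
Proof. by rewrite ipC cabs_conj. Qed.

(** Applying the isometry [pi j] to both arguments on the right costs only a phase, invisible in the
    squared modulus. *)
Lemma csq_shift j k f g :
  csq (ip (pi j f) (pi k g)) = csq (ip f (pi (k - j) g)).
Proof.
have [c [c1 piE]] := piD j (k - j).
rewrite -(pi_iso j f) piE ipZr cabsM_sq cabs_conj c1 mul1r.
by rewrite addrC subrK.
Qed.

Lemma csq_shiftN k f g : csq (ip f (pi k g)) = csq (ip (pi (- k) f) g).
Proof. by rewrite -{2}[g]pi0 csq_shift sub0r opprK. Qed.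

Lemma frame_sum_shift j f g : frame_sum (pi j f) g = frame_sum f g.
Proof.
rewrite /frame_sum (reindex_esum setT setT (+%R^~ j)).
  by apply: eq_esum => k _; rewrite csq_shift addrK.
split => //; first by move=> x y _ _; exact: addIr.
by move=> y _; exists (y - j); rewrite ?subrK.
Qed.

(** Replacing [k] by [- k] exchanges window and analysed vector; this symmetry is what makes the
    trace argument work. *)
Lemma frame_sumC f g : frame_sum f g = frame_sum g f.
Proof.
rewrite /frame_sum (reindex_esum setT setT (-%R : K -> K)).
  by apply: eq_esum => k _; rewrite csq_shiftN opprK csq_ipC.
by split.
Qed.

Lemma tight_nsq_eq A h k : ip_selfadj A ->
  (forall j f, A (pi j f) ~~ pi j (A f)) -> tight h -> tight k ->
  nsq (A h) = nsq (A k).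
Proof.
move=> sA Api th tk; apply: EFin_inj; rewrite -tk -th frame_sumC.
rewrite /frame_sum; apply: eq_esum => j _.
by rewrite sA (ip_equivr _ (Api _ _)).
Qed.

(** * The frame operator [S] and its inverse square root [T] *)

Variables (g : V) (S T : V -> V) (M B : R).
Hypothesis S_frame : forall f, frame_sum f g = (rip (S f) f)%:E.
Hypothesis S_le : forall f, rip (S f) f <= B * nsq f.
Hypothesis T_selfadj : ip_selfadj T.
Hypothesis T_ge0 : forall f, 0 <= rip (T f) f.
Hypothesis T_bounded : forall f, nsq (T f) <= M ^+ 2 * nsq f.
Hypothesis TTS : forall f, T (T (S f)) ~~ f.
Hypothesis STT : forall f, S (T (T f)) ~~ f.

(** [S] inverts the self-adjoint [T T]: writing [w] as [T T S w] moves both copies of [T] onto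
    [S f]. *)
Lemma S_selfadj : ip_selfadj S.
Proof.
move=> f w; rewrite -(ip_equivr _ (TTS w)) -!T_selfadj.
by rewrite TTS.
Qed.

Lemma ST_comm f : S (T f) ~~ T (S f).
Proof.
move=> w; rewrite -(STT (T (S f))).
by apply/(selfadj_equiv S_selfadj)/(selfadj_equiv T_selfadj)/ip_equiv_sym/TTS.
Qed.

Lemma TST f : T (S (T f)) ~~ f.
Proof. by move=> w; rewrite (selfadj_equiv T_selfadj (ST_comm f)) TTS. Qed.

(** Shift invariance of the frame sum gives invariance of the quadratic form of [S]; polarisation
    recovers the full form, and surjectivity of [pi j] turns this into commutation. *)
Lemma S_pi j f : S (pi j f) ~~ pi j (S f).
Proof.
have quad u : rip (S (pi j u)) (pi j u) = rip (S u) u.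
  by apply: EFin_inj; rewrite -!S_frame frame_sum_shift.
have re u v : rip (S (pi j u)) (pi j v) = rip (S u) v.
  have := quad (1%:C *: u + v); rewrite pi_lin !(selfadjP _ _ _ S_selfadj).
  rewrite !ripPl !ripPr !quad !mul1r.
  have -> : rip (S (pi j v)) (pi j u) = rip (S (pi j u)) (pi j v).
    by rewrite S_selfadj ripC.
  have -> : rip (S v) u = rip (S u) v by rewrite S_selfadj ripC.
  lra.
move=> w; have [v <-] := pi_onto j w; rewrite pi_iso.
apply: complex_eqP; first exact: re.
have := re f ('i%C *: v); rewrite pi_scale !ipZr !ReM /=; lra.
Qed.

(** Since [f] is equivalent to [T S T f], the left side is [<S T f, T f>]: the upper frame bound of
    [S] becomes a lower bound for [T]. *)
Lemma nsq_le_T f : nsq f <= B * nsq (T f).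
Proof.
rewrite -[X in complex.Re X <= _](TST f f) T_selfadj; exact: S_le.
Qed.

Hypothesis M_ge1 : 1 <= M.
Hypothesis B_ge1 : 1 <= B.

Lemma T_pi j f : T (pi j f) ~~ pi j (T f).
Proof.
apply: (sqrt_commutes T_selfadj T_ge0 M_ge1 T_bounded B_ge1 nsq_le_T) => //.
- exact: pi_onto.
- move=> {}f; apply: ip_equiv_sym.
  (* T T U ~ T T U (S T T) ~ (T T S) U T T ~ U T T for U := pi j. *)
  apply: (@ip_equiv_trans (T (T (S (pi j (T (T f))))))).
    by apply: ip_equiv_sym; exact: TTS.
  do 2 apply: selfadj_equiv => //.
  apply: (ip_equiv_trans (S_pi _ _)).
  by apply: pi_equiv; exact: STT.
Qed.

(** Moving [T] across each coefficient turns the sum into [<S T f, T f>], which is [||f||^2]. *)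
Lemma tight_window : tight (T g).
Proof.
move=> f; rewrite -(TST f f) T_selfadj -S_frame /frame_sum.
by apply: eq_esum => k _; rewrite T_selfadj (ip_equivr _ (T_pi _ _)).
Qed.

(** The composite [S \o T] plays the role of [S^{1/2}]. *)
Lemma ST_selfadj : ip_selfadj (S \o T).
Proof. by move=> f w /=; rewrite ST_comm T_selfadj S_selfadj. Qed.

(** The value equals [<T u, u>] with [u = T S f]. *)
Lemma ST_ge0 f : 0 <= rip (S (T f)) f.
Proof.
rewrite -(ip_equivr _ (TTS f)) -T_selfadj TST -(TTS f).
exact: T_ge0.
Qed.

(** * Comparison with an arbitrary tight window *)

Variable h : V.
Hypothesis h_tight : tight h.

Lemma nsq_scaleD_ST x : nsq (x%:C *: h + S (T h)) =
  nsq (x%:C *: T g + S (T (T g))).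
Proof.
apply: (@tight_nsq_eq (fun f => x%:C *: f + S (T f))) => //.
- move=> f w; rewrite ipPl ipPr (ST_selfadj f w); congr (_ * _ + _).
  by apply: complex_eqP => //=; rewrite oppr0.
- move=> j f w; rewrite pi_lin !ipPl; congr (_ + _).
  by rewrite (selfadj_equiv S_selfadj (T_pi _ _)) S_pi.
- exact: tight_window.
Qed.

Lemma tight_nsq : nsq h = nsq (T g).
Proof. by apply: (@tight_nsq_eq id) => //; exact: tight_window. Qed.

(** Subtracting the cases [x = 1] and [x = -1] of [nsq_scaleD_ST] isolates the cross term. *)
Lemma tight_ST : rip (S (T h)) h = rip g (T g).
Proof.
have := nsq_scaleD_ST 1; have := nsq_scaleD_ST (-1).
by rewrite !nsqP tight_nsq -(STT g (T g)) !(ripC (S _) _); lra.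
Qed.

Lemma rip_window_ge0 x :
  0 <= x ^+ 2 * rip g (T g) + x * rip g h *+ 2 + rip g (T g).
Proof.
have := ST_ge0 (x%:C *: h + T g).
rewrite -/((S \o T) _) (selfadjP _ _ _ ST_selfadj) ripPl !ripPr /= tight_ST.
rewrite !STT.
have -> : rip (S (T h)) (T g) = rip g h.
  by rewrite -/((S \o T) _) ST_selfadj ripC /= STT.
by congr (0 <= _); ring.
Qed.

Theorem best_tight_window :
  nsq (g - T g) <= nsq (g - h) <= nsq (g + T g).
Proof.
have subE v : g - v = (-1)%:C *: v + g.
  by rewrite rmorphN1 scaleN1r addrC.
have addE v : g + v = 1%:C *: v + g by rewrite rmorph1 scale1r addrC.
rewrite !subE addE !nsqP tight_nsq !(ripC _ g).
(* The windows [h] and [T g] have equal norm, so only inner products with [g] matter: [x = -1] gives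
   the left inequality, [x = 1] the right one. *)
have := rip_window_ge0 1; have := rip_window_ge0 (-1).
by move=> ? ?; apply/andP; split; lra.
Qed.

End ProjectiveRepresentation.
End SemiInnerProduct.

(** * The module of square-integrable functions and the quadratic form of the frame operator *)

Section L2space.
Variable R : realType.
Implicit Types (f g : R -> R[i]).

Lemma L2_0 : L2 (fun _ : R => 0 : R[i]).
Proof.
apply/L2P; split; first by split; exact: measurable_cst.
under eq_integral do rewrite cabs_sq /= expr0n addr0.
by rewrite integral0.
Qed.

(** The codomain [R[i]^o] is the field seen as a module over itself, so functions carry complex
    scaling. *)
Definition L2_pred : {pred R -> R[i]^o} := fun f => `[< L2 f >].

Lemma L2_submod_closed : submod_closed L2_pred.
Proof.
split; first exact/asboolP/L2_0.
by move=> c f g /asboolP lf /asboolP lg; apply/asboolP; exact: L2_comb.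
Qed.

HB.instance Definition _ := GRing.isSubmodClosed.Build _ _ L2_pred
  L2_submod_closed.

Record L2fun := MkL2fun { L2val : R -> R[i]^o; _ : L2val \in L2_pred }.

HB.instance Definition _ := [isSub for L2val].
HB.instance Definition _ := [Choice of L2fun by <:].
HB.instance Definition _ := [SubChoice_isSubLmodule of L2fun by <:].

Lemma L2valP (u : L2fun) : L2 (L2val u).
Proof. by case: u => f /= /asboolP. Qed.

Definition toL2 f (lf : L2 f) : L2fun := MkL2fun (asboolT lf).

Definition ipL2 (u v : L2fun) : R[i] := inner (L2val u) (L2val v).

Lemma ipL2Pl c u v w : ipL2 (c *: u + v) w = c * ipL2 u w + ipL2 v w.
Proof. exact: (inner_comb c (L2valP u) (L2valP v) (L2valP w)). Qed.

Lemma ipL2C u v : ipL2 v u = (ipL2 u v)^*.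
Proof. exact: inner_conj (L2valP u) (L2valP v). Qed.

Lemma ipL2_nsq u : complex.Re (ipL2 u u) = norm2 (L2val u) ^+ 2.
Proof. exact: inner_self (L2valP u). Qed.

Lemma ipL2_ge0 u : 0 <= complex.Re (ipL2 u u).
Proof. by rewrite ipL2_nsq sqr_ge0. Qed.

Definition liftL2 (A : (R -> R[i]) -> (R -> R[i]))
  (LA : forall f, L2 f -> L2 (A f)) (u : L2fun) : L2fun :=
  toL2 (LA _ (L2valP u)).

Lemma Re_inner_le f g : L2 f -> L2 g ->
  `|complex.Re (inner f g)| <= norm2 f * norm2 g.
Proof.
move=> lf lg.
have := cauchy_schwarz ipL2Pl ipL2C ipL2_ge0 (toL2 lf) (toL2 lg).
rewrite !ipL2_nsq /ipL2 /= -exprMn -[X in X <= _]real_normK ?num_real //.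
by rewrite ler_pXn2r // nnegrE mulr_ge0 ?norm2_ge0.
Qed.

Variables a b : R.
Local Notation K := (int * int)%type.

Lemma L2_sum (I : Type) (s : seq I) (c : I -> R[i]) (u : I -> R -> R[i]) :
  (forall i, L2 (u i)) -> L2 (fun t => \sum_(i <- s) c i * u i t).
Proof.
move=> lu; elim: s => [|i s IHs].
  by under eq_fun do rewrite big_nil; exact: L2_0.
by under eq_fun do rewrite big_cons; exact: L2_comb.
Qed.

Lemma inner0 h : inner (fun _ : R => 0 : R[i]) h = 0.
Proof.
apply: complex_eqP; rewrite /inner /cintegral /=.
  under eq_Rintegral do rewrite mul0r.
  by rewrite /Rintegral integral0.
under eq_Rintegral do rewrite mul0r.
by rewrite /Rintegral integral0.
Qed.

Lemma inner_sum (I : Type) (s : seq I) (c : I -> R[i]) (u : I -> R -> R[i]) h :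
  (forall i, L2 (u i)) -> L2 h ->
  inner (fun t => \sum_(i <- s) c i * u i t) h =
  \sum_(i <- s) c i * inner (u i) h.
Proof.
move=> lu lh; elim: s => [|i s IHs].
  by under eq_fun do rewrite big_nil; rewrite inner0 big_nil.
under eq_fun do rewrite big_cons.
by rewrite inner_comb ?IHs ?big_cons //; exact: L2_sum.
Qed.

Lemma ler_sum_fset (I : choiceType) (A B : {fset I}) (c : I -> R) :
  (forall i, 0 <= c i) -> (A `<=` B)%fset ->
  \sum_(i <- A) c i <= \sum_(i <- B) c i.
Proof.
move=> c0 AB.
have -> : \sum_(i <- A) c i = \sum_(i <- A) (if i \in A then c i else 0).
  by apply: eq_big_seq => i ->.
rewrite (big_fset_incl _ AB); last by move=> i _ /negbTE ->.
by apply: ler_sum => i _; case: ifP.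
Qed.

(** Pairing the partial sums of [S f] with [f] gives the partial sums of squares. By Cauchy-Schwarz
    they converge to [<S f, f>], and for nonnegative terms this limit is the supremum defining the
    sum. *)
Lemma frame_operator_quad g S : L2 g -> is_frame_operator g a b S ->
  forall f, L2 f ->
  \esum_(k in [set: K]) (cabs (inner f (gabor_atom g a b k)) ^+ 2)%:E =
  (complex.Re (inner (S f) f))%:E.
Proof.
move=> lg SF f lf; have [lSf approx] := SF f lf.
have latom k : L2 (gabor_atom g a b k) by exact: L2_gabor_atom.
pose atom k := gabor_atom g a b k.
pose c k := cabs (inner f (atom k)) ^+ 2.
pose s := complex.Re (inner (S f) f).
have near e : 0 < e -> exists F0 : {fset K}, forall F : {fset K},
    (F0 `<=` F)%fset -> `|s - \sum_(k <- F) c k| <= e.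
  (* Adding [1] avoids dividing by a vanishing norm. *)
  move=> e0; have n0 : 0 < norm2 f + 1 by rewrite ltr_wpDl ?norm2_ge0.
  have [F0 HF0] := approx (e / (norm2 f + 1)) (divr_gt0 e0 n0).
  exists F0 => F /HF0 lt_e.
  set G := fun t => \sum_(k <- F) inner f (atom k) * atom k t.
  have lG : L2 G by exact: L2_sum.
  have dE : (fun t => S f t - G t) = (fun t => -1 * G t + S f t).
    by apply: funext => t; rewrite mulN1r addrC.
  have ld : L2 (fun t => S f t - G t) by rewrite dE; exact: L2_comb.
  have -> : s - \sum_(k <- F) c k = complex.Re (inner (fun t => S f t - G t) f).
    rewrite dE inner_comb // inner_sum // ReD mulN1r addrC.
    have -> : \sum_(k <- F) inner f (atom k) * inner (atom k) f =
        (\sum_(k <- F) c k)%:C.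
      rewrite rmorph_sum; apply: eq_bigr => k _.
      by rewrite (inner_conj lf (latom k)) /= -mulC_conj mulrC.
    by rewrite addrC.
  apply: (le_trans (Re_inner_le ld lf)).
  apply: (@le_trans _ _ (e / (norm2 f + 1) * (norm2 f + 1))).
    by apply: ler_pM; rewrite ?norm2_ge0 ?lerDl // ltW.
  by rewrite divfK ?gt_eqF.
apply/eqP; rewrite eq_le; apply/andP; split.
  apply: ge_ereal_sup => _ [X [finX _] <-].
  rewrite fsbig_finite // sumEFin lee_fin.
  apply/ler_addgt0Pr => e /near[F0 HF0].
  (* Enlarging [X] by [F0] only increases its sum and makes the approximation available. *)
  have := HF0 (F0 `|` fset_set X)%fset (fsubsetUl _ _).
  rewrite ler_norml lerNl opprB lerBlDl => /andP[+ _].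
  apply: le_trans; apply: ler_sum_fset; last exact: fsubsetUr.
  by move=> k; exact: sqr_ge0.
apply/lee_addgt0Pr => e /near[F0 HF0].
have := HF0 F0 (fsubset_refl _); rewrite ler_norml => /andP[_ le_e].
have le_sum : ((\sum_(k <- F0) c k)%:E <= \esum_(k in [set: K]) (c k)%:E)%E.
  apply: esum_ge; exists [set` F0]; first by split.
  by rewrite fsbig_finite //= set_fsetK sumEFin.
apply: (le_trans _ (leeD2r e%:E le_sum)).
by rewrite -EFinD lee_fin; lra.
Qed.

End L2space.

Theorem theorem2p1 (R : realType) (a b : R) (g : R -> R[i])
    (S T : (R -> R[i]) -> (R -> R[i])) (h0 : R -> R[i]) :
  0 < a -> 0 < b ->
  L2 g -> gabor_frame g a b ->
  is_frame_operator g a b S ->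
  is_inv_sqrt S T ->
  h0 = T g ->
  forall h : R -> R[i], L2 h -> normalized_tight_gabor_frame h a b ->
    norm2 (fun t => g t - h0 t) <= norm2 (fun t => g t - h t) /\
    norm2 (fun t => g t - h t) <= norm2 (fun t => g t + h0 t).
Proof.
move=> _ _ lg [A [B [_ _ frame]]] SF [[LT _ [M bT]] sT pT invT] -> h lh tight_h.
have LS f : L2 f -> L2 (S f) by move=> /SF[].
pose pi k (u : L2fun R) := toL2 (L2_gabor_atom a b k (L2valP u)).
(* Bounds of at least [1] keep the contraction factor [1 - 1 / (B' M'^2)] in [[0, 1)]. *)
pose B' := Num.max 1 B; pose M' := Num.max 1 M.
have B'1 : 1 <= B' by rewrite le_max lexx.
have M'1 : 1 <= M' by rewrite le_max lexx.
have M'0 : 0 <= M' := le_trans ler01 M'1.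
have S_frame u : frame_sum (@ipL2 R) pi u (toL2 lg) =
    (complex.Re (ipL2 (liftL2 LS u) u))%:E.
  exact: frame_operator_quad lg SF _ (L2valP u).
have S_le u : complex.Re (ipL2 (liftL2 LS u) u) <= B' * complex.Re (ipL2 u u).
  rewrite -lee_fin -S_frame ipL2_nsq.
  apply: (le_trans (frame _ (L2valP u)).2).
  by rewrite lee_fin ler_wpM2r ?sqr_ge0 // le_max lexx orbT.
have T_bounded u : complex.Re (ipL2 (liftL2 LT u) (liftL2 LT u)) <=
    M' ^+ 2 * complex.Re (ipL2 u u).
  rewrite !ipL2_nsq -exprMn ler_pXn2r ?nnegrE ?mulr_ge0 ?norm2_ge0 //.
  apply: (le_trans (bT _ (L2valP u))).
  by rewrite ler_wpM2r ?norm2_ge0 // le_max lexx orbT.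
have T_ge0 u : 0 <= complex.Re (ipL2 (liftL2 LT u) u).
  by have := pT _ (L2valP u); rewrite lecE => /andP[].
have TTS u : ip_equiv (@ipL2 R) (liftL2 LT (liftL2 LT (liftL2 LS u))) u.
  move=> w; apply: inner_eq_ae; try exact: L2valP.
  exact: (invT _ (L2valP u)).1.
have STT u : ip_equiv (@ipL2 R) (liftL2 LS (liftL2 LT (liftL2 LT u))) u.
  move=> w; apply: inner_eq_ae; try exact: L2valP.
  exact: (invT _ (L2valP u)).2.
have T_selfadj : ip_selfadj (@ipL2 R) (liftL2 LT).
  by move=> u v; exact: sT _ _ (L2valP u) (L2valP v).
have pi_lin k c u v : pi k (c *: u + v) = c *: pi k u + pi k v.
  by apply: val_inj; exact: gabor_atom_comb.
have pi_iso k u v : ipL2 (pi k u) (pi k v) = ipL2 u v.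
  exact: inner_gabor_atom (L2valP u) (L2valP v).
have pi0 u : pi 0 u = u by apply: val_inj; exact: gabor_atom0.
have piD j k : exists c, cabs c ^+ 2 = 1 /\
    forall u, pi j (pi k u) = c *: pi (j + k) u.
  have [c [c1 E]] := gabor_atomD a b j k.
  by exists c; split=> // u; apply: val_inj; apply: funext => t; exact: E.
have h_tight : tight (@ipL2 R) pi (toL2 lh).
  move=> u; rewrite ipL2_nsq; apply/eqP.
  have [lo up] := tight_h _ (L2valP u); rewrite mul1r in lo up.
  by rewrite eq_le up lo.
have := best_tight_window (@ipL2Pl R) (@ipL2C R) (@ipL2_ge0 R) pi_lin pi_iso pi0
  piD S_frame S_le T_selfadj T_ge0 T_bounded TTS STT M'1 B'1 h_tight.
by rewrite !ipL2_nsq !ler_pXn2r ?nnegrE ?norm2_ge0 // => /andP.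
Qed.
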